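(* Let $n\ge7$ be an integer and let $l_{Y,n},u_{X,n},u_{Y,n}$ be positive finite constants with $l_{Y,n}^2\le u_{Y,n}$. For every $\alpha\in\Big(0,\ 1\wedge n/\big(l_{Y,n}+\sqrt{u_{Y,n}-l_{Y,n}^2}\big)^2\Big)$ and every $\xi<1$, there exists a distribution $Q$ on $\mathbb{R}^2$ satisfying $\mathbb{E}[Y_{1,n}]\ge l_{Y,n}>0$, $\mathbb{E}[X_{1,n}^2]\le u_{X,n}$ and $\mathbb{E}[Y_{1,n}^2]\le u_{Y,n}$ for $(X_{1,n},Y_{1,n})\sim Q$, such that for $(X_{i,n},Y_{i,n})_{i=1}^n$ i.i.d. with distribution $Q$, $$\mathbb{P}_{Q^{\otimes n}}\left(\left|\frac{\overline{X}_n}{\overline{Y}_n}-\frac{\mathbb{E}[X_{1,n}]}{\mathbb{E}[Y_{1,n}]}\right|>\xi\sqrt{\frac{v_n}{3n\alpha}}\right)>\alpha,$$ where $v_n:=u_{X,n}\big/\big(l_{Y,n}+\sqrt{u_{Y,n}-l_{Y,n}^2}\big)^2$.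
   Context: $\overline{X}_n,\overline{Y}_n$ denote the empirical means $n^{-1}\sum_iX_{i,n}$, $n^{-1}\sum_iY_{i,n}$; $a\wedge b=\min(a,b)$. The ratio $\overline{X}_n/\overline{Y}_n$ is undefined when $\overline{Y}_n=0$. *)

(* Defs.v *)
From HB Require Import structures.
From mathcomp Require Import all_boot all_order all_algebra.
From mathcomp Require Import all_classical all_reals all_analysis.

Set Implicit Arguments.
Unset Strict Implicit.
Unset Printing Implicit Defensive.
Import Order.TTheory GRing.Theory Num.Theory.
Local Open Scope classical_set_scope.
Local Open Scope ring_scope.

Section iid_law.
Context d (T : measurableType d).

Definition tuple_cons n (z : T * n.-tuple T) : n.+1.-tuple T :=
  [tuple of z.1 :: z.2].

Lemma measurable_tuple_cons n :
  measurable_fun [set: T * n.-tuple T] (@tuple_cons n).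
Proof. exact: (measurable_cons measurable_fst measurable_snd). Qed.

HB.instance Definition _ n := @isMeasurableFun.Build _ _ _ _ (@tuple_cons n)
  (@measurable_tuple_cons n).

Context (R : realType) (Q : probability T R).

(* The n-fold product of Q. The library equips [n.-tuple T] with the
   sigma-algebra generated by the coordinates but has no product measure on it;
   [iid_lawE] characterizes this one by its values on rectangles. *)
Fixpoint iid_law n : probability (n.-tuple T) R :=
  if n is m.+1 then distribution (Q \x iid_law m)%E (@tuple_cons m)
  else dirac ([tuple] : 0.-tuple T).

Lemma iid_lawE n (A : 'I_n -> set T) : (forall i, measurable (A i)) ->
  iid_law n [set s | forall i, A i (tnth s i)] = (\prod_(i < n) Q (A i))%E.
Proof.
elim: n A => [|n IH] A mA /=.
  by rewrite big_ord0 diracE mem_set// => -[].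
have mB : measurable [set s : n.-tuple T | forall i, A (lift ord0 i) (tnth s i)].
  rewrite (_ : mkset _ =
      \bigcap_(i in [set: 'I_n]) ((@tnth n T ^~ i) @^-1` A (lift ord0 i))).
    apply: fin_bigcap_measurable => // i _.
    by rewrite -[_ @^-1` _]setTI; exact: measurable_tnth.
  by apply/seteqP; split=> [s As i _|s As i]; exact: As.
rewrite big_ord_recl -IH// -product_measure1E// /distribution /pushforward.
congr (_ _); apply/seteqP; split=> [[x s] /= As|[x s] /= [Ax As] i].
  split=> [|i]; first exact: (As ord0).
  by have := As (lift ord0 i); rewrite /tuple_cons tnthS.
by case: (unliftP ord0 i) => [j ->|->]; rewrite /tuple_cons ?tnthS ?tnth0.
Qed.

End iid_law.

Section empirical_means.
Context (R : realType) (n : nat).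

Definition meanX (s : n.-tuple (R * R)) : R :=
  n%:R^-1 * \sum_(i < n) (tnth s i).1.

Definition meanY (s : n.-tuple (R * R)) : R :=
  n%:R^-1 * \sum_(i < n) (tnth s i).2.

End empirical_means.

(* Main.v *)
Require Import Defs.
From HB Require Import structures.
From mathcomp Require Import all_boot all_order all_algebra.
From mathcomp Require Import all_classical all_reals all_analysis.
From mathcomp Require Import measurable_realfun.
From mathcomp Require Import ring lra zify.
Set Implicit Arguments.
Unset Strict Implicit.
Unset Printing Implicit Defensive.
Import Order.TTheory GRing.Theory Num.Theory.
Local Open Scope classical_set_scope.
Local Open Scope ring_scope.

(* Take Y constant equal to lY, so that the ratio is meanX / lY; since
   lY <= lY + sqrt (uY - lY^2), it suffices that |meanX - E[X]| be at least
   sqrt (uX / (3 n alpha)) with probability greater than alpha. In both cases X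
   takes its values in {0, D, -D}, so that the sum of the X_i lies in D Z.

   If alpha <= 2/3, let X be D or -D with probability p/2 each, where
   p = 3 alpha / n. The deviation is large as soon as the sum is nonzero, and a
   lazy random walk returns to 0 at time n with probability at most
   1/4 + (1 - 2p)^n / 4 + (1 - p)^n / 2. This is convex in alpha, equal to 1 at
   alpha = 0 and less than 1/3 at alpha = 2/3, hence less than 1 - alpha.

   If alpha >= 2/3, let X be D with probability 1/(2n) and 0 otherwise. Then the
   sum of the X_i has expectation D/2, which is at distance at least D/2 from
   D Z, so the deviation is large with probability 1. *)

(** * Finitely supported laws and their products *)

Section discrete_law.
Context d (T : measurableType d) (R : realType) (N : nat).
Variables (w : nat -> {nonneg R}) (x : nat -> T).
Hypothesis w1 : \sum_(i < N) (w i)%:num = 1.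

(* The normalization proof is an argument so that canonical structure inference
   can find the probability instance. *)
Definition discrete_law of (\sum_(i < N) (w i)%:num = 1) :=
  msum (fun i => mscale (w i) (dirac (x i) : {measure set T -> \bar R})) N.

HB.instance Definition _ := Measure.on (discrete_law w1).

Let discrete_lawT : discrete_law w1 [set: T] = 1%E.
Proof.
rewrite /discrete_law /msum/= /mscale/= -[in RHS]w1 -sumEFin.
by apply: eq_bigr => i _; rewrite diracT mule1.
Qed.

HB.instance Definition _ :=
  @Measure_isProbability.Build _ _ R (discrete_law w1) discrete_lawT.

Lemma ge0_integral_discrete_law (f : T -> \bar R) :
  (forall t, (0 <= f t)%E) -> measurable_fun [set: T] f ->
  (\int[discrete_law w1]_t f t = \sum_(i < N) (w i)%:num%:E * f (x i))%E.
Proof.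
move=> f0 mf; rewrite /discrete_law ge0_integral_measure_sum//.
apply: eq_bigr => i _; rewrite ge0_integral_mscale//.
by rewrite integral_dirac// diracT mul1e.
Qed.

(** The positive and negative parts of [f] have finite integrals against finitely many atoms, so
    their difference recombines atom by atom. *)
Lemma expectation_discrete_law (f : T -> R) : measurable_fun [set: T] f ->
  ('E_(discrete_law w1)[f] = (\sum_(i < N) (w i)%:num * f (x i))%:E)%E.
Proof.
move=> mf; have mEf : measurable_fun [set: T] (EFin \o f) by exact/measurable_EFinP.
rewrite unlock integralE !ge0_integral_discrete_law//; last 2 first.
- exact: measurable_funeneg.
- exact: measurable_funepos.
under eq_bigr do rewrite funeposE/= -EFin_max -EFinM.
under [X in (_ - X)%E]eq_bigr do rewrite funenegE/= -EFin_max -EFinM.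
rewrite !sumEFin -EFinB -sumrB; congr (_%:E); apply: eq_bigr => i _.
by rewrite -mulrBr; congr (_ * _); rewrite /Num.max; do 2 case: ifP; lra.
Qed.

(** Conditioning on the first coordinate; this is the source of the walk recursion. *)
Lemma iid_law_discreteS n (A : set (n.+1.-tuple T)) : measurable A ->
  (iid_law (discrete_law w1) n.+1 A =
   \sum_(i < N) (w i)%:num%:E *
     iid_law (discrete_law w1) n [set s | A (tuple_cons (x i, s))])%E.
Proof.
move=> mA /=; rewrite /distribution /pushforward /= /product_measure1.
rewrite ge0_integral_discrete_law//.
  apply: eq_bigr => i _; congr (_ * _)%E; congr (iid_law _ _ _).
  by apply/seteqP; split=> s; rewrite /xsection/= inE.
apply: measurable_fun_xsection.
by rewrite -[_ @^-1` _]setTI; exact: measurable_tuple_cons.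
Qed.

Lemma iid_law_discrete_support n (S : set T) : measurable S ->
  (forall i, (i < N)%N -> S (x i)) ->
  iid_law (discrete_law w1) n [set s | forall i, S (tnth s i)] = 1%E.
Proof.
move=> mS Sx; rewrite (iid_lawE _ (fun=> mS)) big1// => i _.
rewrite /discrete_law /msum/= /mscale/=.
rewrite -[RHS]discrete_lawT /discrete_law /msum/= /mscale/=.
by apply: eq_bigr => j _; rewrite !diracE !mem_set//; exact: Sx.
Qed.

End discrete_law.

Lemma measurable_forall_tnth d (T : measurableType d) n (S : set T) :
  measurable S -> measurable [set s : n.-tuple T | forall i, S (tnth s i)].
Proof.
move=> mS; rewrite (_ : mkset _ =
    \bigcap_(i in [set: 'I_n]) ((@tnth n T ^~ i) @^-1` S)).
  apply: fin_bigcap_measurable => // i _.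
  by rewrite -[_ @^-1` _]setTI; exact: measurable_tnth.
by apply/seteqP; split=> [s Ss i _|s Ss i]; exact: Ss.
Qed.

(** [A] lies in the union of [B] and the complement of [S], which is null. *)
Lemma le_probability_support d (T : measurableType d) (R : realType)
    (P : probability T R) (S A B : set T) :
  measurable S -> measurable A -> measurable B -> P S = 1%E ->
  S `&` A `<=` B -> (P A <= P B)%E.
Proof.
move=> mS mA mB PS SAB.
have PSc : P (~` S) = 0%E by rewrite probability_setC// PS subee.
apply: (@le_trans _ _ (P (B `|` ~` S))); last first.
  by rewrite -[leRHS]adde0 -PSc measureU2//; exact: measurableC.
apply: le_measure; rewrite ?inE//; first by apply: measurableU => //; exact: measurableC.
by move=> t At; have [St|nSt] := pselect (S t); [left; exact: SAB|right].
Qed.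

(** * Return probability of a lazy random walk *)

Section lazy_walk.
Variables (R : realFieldType) (p : R) (u : nat -> int -> R).
Hypotheses (p0 : 0 <= p) (p1 : p <= 1).
Hypothesis u0 : forall k, u 0 k = (k == 0)%:R.
Hypothesis uS : forall n k,
  u n.+1 k = (1 - p) * u n k + p / 2 * (u n (k - 1) + u n (k + 1)).

(** Probability that the walk has the parity of [k] at time [n]: each step flips the parity with
    probability [p], so (-1) to the position has mean (1 - 2p)^n. *)
Let e n (k : int) : R := (1 + (-1) ^ k * (1 - 2 * p) ^+ n) / 2.

Let signS (k : int) : (-1) ^ (k + 1) = - (-1) ^ k :> R.
Proof. by rewrite expfzDr ?oppr_eq0 ?oner_eq0// expr1z mulrN1. Qed.

Let signP (k : int) : (-1) ^ (k - 1) = - (-1) ^ k :> R.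
Proof. by rewrite -[in RHS](subrK 1 k) signS opprK. Qed.

Let eP n k : e n (k - 1) = e n (k + 1).
Proof. by rewrite /e signS signP. Qed.

Let eS n k : e n.+1 k = (1 - p) * e n k + p * e n (k + 1).
Proof. by rewrite /e signS exprS; field. Qed.

Let sign_ge (k : int) : -1 <= (-1) ^ k :> R.
Proof.
by rewrite expN1r -signr_odd; case: odd; rewrite ?expr1 ?expr0; lra.
Qed.

(* The walk is never at both k and k + 2, and is at one of them only when the
   parity is right, which has probability e n k. *)
Let u_pair n k : u n k + u n (k + 2) <= e n k.
Proof.
elim: n k => [|n IH] k.
  rewrite !u0 /e expr0 mulr1.
  have [->/=|k0] := eqVneq k 0; first by rewrite expr0z; lra.
  have [k2/=|_/=] := eqVneq (k + 2) 0; last by have := sign_ge k; lra.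
  have -> : k = - 2 by rewrite -[k](addrK 2) k2 sub0r.
  by rewrite expN1r (_ : `|- 2 : int|%N = 2%N)// sqrrN expr1n; lra.
rewrite !uS eS.
have -> : k + 2 - 1 = k - 1 + 2 by ring.
have -> : k + 2 + 1 = k + 1 + 2 by ring.
have q0 : 0 <= 1 - p by rewrite subr_ge0.
have h1 := ler_wpM2l q0 (IH k).
have h2 := ler_wpM2l p0 (IH (k - 1)).
have h3 := ler_wpM2l p0 (IH (k + 1)).
rewrite eP in h2.
lra.
Qed.

(** A move into [k] starts from [k - 1] or [k + 1], a pair controlled by [u_pair], and is taken with
    probability p/2; this gives the factor 2. The walk that has never moved contributes the extra (1
    - p)^n at 0. *)
Let u_single n k : 2 * u n k <= e n k + (k == 0)%:R * (1 - p) ^+ n.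
Proof.
elim: n k => [|n IH] k.
  rewrite u0 /e !expr0 !mulr1.
  have [->/=|k0/=] := eqVneq k 0; first by rewrite expr0z; lra.
  by have := sign_ge k; lra.
rewrite uS eS exprS.
have q0 : 0 <= 1 - p by rewrite subr_ge0.
have h1 := ler_wpM2l q0 (IH k).
have h2 := ler_wpM2l p0 (u_pair n (k - 1)).
rewrite eP (_ : k - 1 + 2 = k + 1) in h2; last by ring.
lra.
Qed.

Lemma lazy_walk_return n :
  u n 0 <= 1 / 4 + (1 - 2 * p) ^+ n / 4 + (1 - p) ^+ n / 2.
Proof. by have := u_single n 0; rewrite /e eqxx expr0z !mul1r; lra. Qed.

End lazy_walk.

(** * Bounds on the powers in the return estimate *)

(** Convexity in [t]: on [0, 1] the graph lies below the chord joining its endpoints. *)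
Lemma chord_exprn (R : realFieldType) (t c : R) n :
  0 <= t <= 1 -> 0 <= c <= 1 -> (1 - t * c) ^+ n <= 1 - t + t * (1 - c) ^+ n.
Proof.
move=> /andP[t0 t1] /andP[c0 c1]; elim: n => [|n IH]; first by rewrite !expr0; lra.
rewrite !exprS.
have X1 : (1 - c) ^+ n <= 1 by apply: exprn_ile1; lra.
have X0 : 0 <= (1 - c) ^+ n by apply: exprn_ge0; lra.
have h := ler_wpM2l (_ : 0 <= 1 - t * c) IH.
apply: le_trans (h _) _; first nra.
(* This product is exactly the slack of the induction step. *)
have : 0 <= t * (1 - t) * (c * (1 - (1 - c) ^+ n)).
  by apply: mulr_ge0; apply: mulr_ge0; lra.
nra.
Qed.

(** The case alpha = 2/3, where p = 2/n: the return bound is then below 1/4 + 1/12 = 1/3. The powers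
    are compared with exp(-4) and exp(-2); [n >= 4] keeps their bases nonnegative. *)
Lemma one_sub_exprn_lt (R : realType) n : (4 <= n)%N ->
   (1 - 4 / n%:R) ^+ n / 4 + (1 - 2 / n%:R) ^+ n / 2 < 1 / 12 :> R.
Proof.
move=> n4.
have n0 : (0 : R) < n%:R by rewrite ltr0n; case: n n4.
have n4R : (4 : R) <= n%:R by rewrite ler_nat.
have H (c : R) : 0 <= c <= 4 -> (1 - c / n%:R) ^+ n <= expR (- c).
  move=> /andP[c0 c4].
  have -> : expR (- c) = expR (- c / n%:R) ^+ n.
    by rewrite -expRM_natl; congr expR; field; rewrite gt_eqF.
  apply: lerXn2r; rewrite ?nnegrE ?expR_ge0//.
    by rewrite subr_ge0 ler_pdivrMr// mul1r; lra.
  by rewrite mulNr expR_ge1Dx.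
(* From 1 + 1/8 <= exp(1/8), raised to the power 16; 38/250 is a rational slightly above
   (8/9)^16. *)
have e2 : (9 / 8) ^+ 16 <= expR 2 :> R.
  rewrite (_ : 2 = 16%:R * (1 / 8) :> R); last by field.
  rewrite expRM_natl; apply: lerXn2r; rewrite ?nnegrE ?expR_ge0//.
  by apply: le_trans (expR_ge1Dx _); lra.
have e2' : expR (- 2) <= 38 / 250 :> R.
  by rewrite expRN -div1r ler_pdivrMr ?expR_gt0//; lra.
have e4 : expR (- 4) = expR (- 2) ^+ 2 :> R.
  by rewrite -expRM_natl; congr expR; ring.
have := H 2 ltac:(lra); have := H 4 ltac:(lra).
rewrite e4 => a4 a2.
have : expR (- 2) ^+ 2 <= (38 / 250) ^+ 2 :> R.
  by apply: lerXn2r; rewrite ?nnegrE ?expR_ge0//; lra.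
lra.
Qed.

(** * Laws with X in {0, D, -D} and Y constant *)

Section lattice_law.
Context (R : realType) (D L : R) (w : nat -> {nonneg R}).
Hypothesis w1 : \sum_(i < 3) (w i)%:num = 1.

(** The same atoms serve both ranges of alpha; for large alpha the third has weight 0. *)
Definition lattice_atom (i : nat) : R * R :=
  match i with 0 => (0, L) | 1 => (D, L) | _ => (- D, L) end.

Let Q : probability (R * R)%type R := discrete_law lattice_atom w1.

Lemma expectation_lattice_law (f : R * R -> R) : measurable_fun [set: R * R] f ->
  ('E_Q[f] = ((w 0%N)%:num * f (0%R, L) + (w 1%N)%:num * f (D, L)
              + (w 2%N)%:num * f (- D, L))%:E)%E.
Proof.
move=> mf; rewrite expectation_discrete_law//.
by rewrite !big_ord_recr big_ord0/= add0r.
Qed.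

Definition sumX n (s : n.-tuple (R * R)) : R := \sum_(i < n) (tnth s i).1.

Lemma sumX_cons n (z : R * R) (s : n.-tuple (R * R)) :
  sumX (tuple_cons (z, s)) = z.1 + sumX s.
Proof.
rewrite /sumX big_ord_recl /tuple_cons tnth0; congr (_ + _).
by apply: eq_bigr => i _; rewrite tnthS.
Qed.

Lemma measurable_sumX n : measurable_fun [set: n.-tuple (R * R)] (@sumX n).
Proof.
apply: measurable_sum => i.
exact: (measurableT_comp measurable_fst (measurable_tnth i)).
Qed.

Lemma measurable_sumX_eq n (r : R) :
  measurable [set s : n.-tuple (R * R) | sumX s = r].
Proof.
by rewrite -[mkset _]setTI; exact: (measurable_sumX measurableT (measurable_set1 r)).
Qed.

Definition sumX_pmf n (k : int) : R :=
  fine (iid_law Q n [set s | sumX s = D * k%:~R]).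

Lemma sumX_pmf0 k : 0 < D -> sumX_pmf 0 k = (k == 0)%:R.
Proof.
move=> D0; rewrite /sumX_pmf/= indicE.
congr (nat_of_bool _)%:R; apply/idP/idP.
  rewrite inE /sumX/= big_ord0 => /esym/eqP.
  by rewrite mulf_eq0 gt_eqF//= intr_eq0.
by move=> /eqP ->; rewrite inE /sumX/= big_ord0 mulr0.
Qed.

(** Conditioning on the first X. With equal weights on [D] and [- D] this is the lazy walk
    recursion. *)
Lemma sumX_pmfS n k : sumX_pmf n.+1 k = (w 0%N)%:num * sumX_pmf n k
  + (w 1%N)%:num * sumX_pmf n (k - 1) + (w 2%N)%:num * sumX_pmf n (k + 1).
Proof.
have step (z : R) (m : int) : z + D * m%:~R = D * k%:~R ->
    iid_law Q n [set s | sumX (tuple_cons ((z, L), s)) = D * k%:~R]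
    = (sumX_pmf n m)%:E.
  move=> zm; rewrite /sumX_pmf fineK ?fin_num_measure//; last first.
    exact: measurable_sumX_eq.
  congr (iid_law _ _ _); by apply/seteqP; split=> s /=; rewrite sumX_cons/= -zm; [move/addrI|move->].
rewrite {1}/sumX_pmf iid_law_discreteS; last exact: measurable_sumX_eq.
rewrite !big_ord_recr big_ord0/= add0e.
rewrite (step 0 k) ?add0r//.
rewrite (step D (k - 1)); last by rewrite intrB; ring.
rewrite (step (- D) (k + 1)); last by rewrite intrD; ring.
by rewrite -!EFinM -!EFinD.
Qed.

(** Almost surely every pair is an atom, so [meanY] is [L] and the sum lies in D Z; the inclusion of
    [A] in [B] need only be checked on such samples. *)
Lemma iid_lattice_law_le n (A B : set (n.-tuple (R * R))) : (0 < n)%N ->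
  measurable A -> measurable B ->
  (forall s, A s -> meanY s = L -> (exists m : int, sumX s = D * m%:~R) -> B s) ->
  (iid_law Q n A <= iid_law Q n B)%E.
Proof.
move=> n0 mA mB AB.
pose S : set (R * R) := ([set 0] `|` [set D] `|` [set - D]) `*` [set L].
have mS : measurable S.
  by apply: measurableX => //; do 2 apply: measurableU => //.
have QS : iid_law Q n [set s | forall i, S (tnth s i)] = 1%E.
  apply: iid_law_discrete_support => // -[|[|i]] _; split=> //=; first by left; left.
  + by left; right.
  + by right.
apply: (le_probability_support _ mA mB QS); first exact: measurable_forall_tnth.
move=> s [Ss As]; apply: AB => //.
  rewrite /meanY (eq_bigr (fun=> L)); last by move=> i _; have [_] := Ss i.
  by rewrite big_const_ord iter_addr addr0 -[L *+ n]mulr_natl mulKf// pnatr_eq0 -lt0n.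
rewrite /sumX; apply: (big_ind (fun r => exists m : int, r = D * m%:~R)).
- by exists 0; rewrite mulr0.
- by move=> _ _ [m ->] [m' ->]; exists (m + m'); rewrite intrD mulrDr.
- move=> i _; have [[[->|->]|->] _] := Ss i.
  + by exists 0; rewrite mulr0.
  + by exists 1; rewrite mulr1.
  + by exists (-1); rewrite mulrN1.
Qed.

End lattice_law.

(** * The deviation event and its threshold *)

(** Multiplying through by |meanY| turns the event into the positivity of two functions built from
    the means without division. *)
Lemma measurable_ratio_event (R : realType) n (t c : R) :
  measurable [set s : n.-tuple (R * R) |
    meanY s != 0 /\ t < `|meanX s / meanY s - c|].
Proof.
have mX : measurable_fun [set: n.-tuple (R * R)] (@meanX R n).
  apply: measurable_funM => //; apply: measurable_sum => i.
  exact: (measurableT_comp measurable_fst (measurable_tnth i)).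
have mY : measurable_fun [set: n.-tuple (R * R)] (@meanY R n).
  apply: measurable_funM => //; apply: measurable_sum => i.
  exact: (measurableT_comp measurable_snd (measurable_tnth i)).
have mN (f : n.-tuple (R * R) -> R) : measurable_fun setT f ->
    measurable_fun setT (fun s => `|f s|).
  by move=> mf; exact: measurableT_comp.
rewrite (_ : mkset _ = [set s : n.-tuple (R * R) | 0 < `|meanY s|] `&`
  [set s : n.-tuple (R * R) | 0 < `|meanX s - c * meanY s| - t * `|meanY s| ]).
  have pos (f : n.-tuple (R * R) -> R) : measurable_fun setT f ->
      measurable [set s | 0 < f s].
    move=> mf; rewrite [X in measurable X](_ : _ = [set: _] `&` f @^-1` `]0, +oo[%classic).
      exact: mf.
    by rewrite setTI; apply/seteqP; split=> s /=; rewrite in_itv/= andbT.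
  apply: measurableI; apply: pos; first exact: mN.
  apply: measurable_funB; last by apply: measurable_funM => //; exact: mN.
  apply: mN; apply: measurable_funB => //.
  exact: measurable_funM.
apply/seteqP; split=> s /=; rewrite normr_gt0 subr_gt0 => -[y0 h]; split=> //; move: h.
  rewrite -ltr_pdivlMr ?normr_gt0// -normf_div mulrBl mulfK//.
by rewrite -ltr_pdivlMr ?normr_gt0// -normf_div mulrBl mulfK.
Qed.

(** Strictness comes from [xi < 1], so afterwards it suffices that the deviation of [meanX] be at
    least sqrt(u/k), with equality allowed. *)
Lemma scaled_sqrt_lt (R : realType) (L sg u k xi : R) :
  0 < L -> 0 <= sg -> 0 < u -> 0 < k -> xi < 1 ->
  xi * Num.sqrt (u / (L + sg) ^+ 2 / k) < Num.sqrt (u / k) / L.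
Proof.
move=> L0 sg0 u0 k0 xi1.
have M0 : 0 < L + sg by lra.
rewrite mulrAC sqrtrM ?divr_ge0 ?ltW// sqrtrV ?exprn_ge0 ?ltW//.
rewrite sqrtr_sqr gtr0_norm//.
have y0 : 0 < Num.sqrt (u / k) by rewrite sqrtr_gt0 divr_gt0.
apply: (@lt_le_trans _ _ (Num.sqrt (u / k) / (L + sg))).
  by rewrite gtr_pMl ?divr_gt0.
by rewrite ler_pM2l// lef_pV2 ?posrE//; lra.
Qed.

(** * Weights, moments and the two ranges of alpha *)

Section weights.
Context (R : realType) (a b c : R).
Hypotheses (a0 : 0 <= a) (b0 : 0 <= b) (c0 : 0 <= c) (abc : a + b + c = 1).

Definition weight3 (i : nat) : {nonneg R} :=
  match i with 0 => NngNum a0 | 1 => NngNum b0 | _ => NngNum c0 end.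

Lemma sum_weight3 : \sum_(i < 3) (weight3 i)%:num = 1.
Proof. by rewrite !big_ord_recr big_ord0/= add0r. Qed.

End weights.

Lemma lattice_law_moments (R : realType) (D L : R) (w : nat -> {nonneg R})
    (w1 : \sum_(i < 3) (w i)%:num = 1) :
  let Q := discrete_law (lattice_atom D L) w1 in
  [/\ 'E_Q[fun z => z.1] = (D * ((w 1%N)%:num - (w 2%N)%:num))%:E,
      'E_Q[fun z => z.2] = L%:E,
      'E_Q[(fun z => z.1 ^+ 2)%R] = (D ^+ 2 * ((w 1%N)%:num + (w 2%N)%:num))%:E
    & 'E_Q[(fun z => z.2 ^+ 2)%R] = (L ^+ 2)%:E]%E.
Proof.
have w01 : (w 0%N)%:num + (w 1%N)%:num + (w 2%N)%:num = 1.
  by move: w1; rewrite !big_ord_recr big_ord0/= add0r.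
split; rewrite expectation_lattice_law/=.
- by congr _%:E; ring.
- exact: measurable_fst.
- by rewrite -!mulrDl w01 mul1r.
- exact: measurable_snd.
- by congr _%:E; ring.
- by apply: measurable_funX; exact: measurable_fst.
- by rewrite -!mulrDl w01 mul1r.
- by apply: measurable_funX; exact: measurable_snd.
Qed.

Lemma ratio_tail_small (R : realType) (n : nat) (L sg u alpha xi : R) :
  (4 <= n)%N -> 0 < L -> 0 <= sg -> 0 < u -> 0 < alpha -> alpha <= 2 / 3 ->
  xi < 1 ->
  exists Q : probability (R * R)%type R,
    [/\ ('E_Q[fun z => z.2] = L%:E)%E, ('E_Q[(fun z => z.1 ^+ 2)%R] = u%:E)%E,
        ('E_Q[(fun z => z.2 ^+ 2)%R] = (L ^+ 2)%:E)%E
      & (alpha%:E < iid_law Q n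
           [set s | (meanY s != 0 /\
              xi * Num.sqrt (u / (L + sg) ^+ 2 / (3 * n%:R * alpha)) <
              `| meanX s / meanY s
                 - fine 'E_Q[fun z => z.1] / fine 'E_Q[fun z => z.2] |)%R])%E].
Proof.
move=> n4 L0 sg0 u0 al0 al23 xi1.
have nR : (4 : R) <= n%:R by rewrite ler_nat.
have n0 : (0 : R) < n%:R by lra.
pose k := 3 * n%:R * alpha.
have k0 : 0 < k by rewrite /k !mulr_gt0.
pose p := 3 * alpha / n%:R.
have p0 : 0 <= p by rewrite divr_ge0//; lra.
have p1 : p <= 1 by rewrite ler_pdivrMr//; lra.
have q0 : 0 <= 1 - p by rewrite subr_ge0.
have h0 : 0 <= p / 2 by rewrite divr_ge0.
have wE : (1 - p) + p / 2 + p / 2 = 1 by field.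
(* One lattice step then moves [meanX] by exactly sqrt(u/k), and D^2 p = u. *)
pose D := n%:R * Num.sqrt (u / k).
have D0 : 0 < D by rewrite mulr_gt0// sqrtr_gt0 divr_gt0.
have [EX EY EX2 EY2] := lattice_law_moments D L (sum_weight3 q0 h0 h0 wE).
exists (discrete_law (lattice_atom D L) (sum_weight3 q0 h0 h0 wE)).
rewrite EX EY EX2 EY2/=; split=> //.
  congr _%:E; rewrite /D exprMn sqr_sqrtr ?divr_ge0 ?ltW//.
  by rewrite /k /p; field; rewrite !gt_eqF.
set U := sumX_pmf D L (sum_weight3 q0 h0 h0 wE).
have U0 : U n 0 < 1 - alpha.
  apply: le_lt_trans (lazy_walk_return p0 p1 _ _ n) _.
  - by move=> m; rewrite /U sumX_pmf0.
  - by move=> m j; rewrite /U sumX_pmfS/=; ring.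
  have := @one_sub_exprn_lt R n n4.
  (* Position of alpha between 0 and 2/3, the endpoints of the chord. *)
  pose t := 3 * alpha / 2.
  have t01 : 0 <= t <= 1 by rewrite /t; lra.
  have c1 : 0 <= (2 / n%:R : R) <= 1.
    by rewrite divr_ge0//= ler_pdivrMr//; lra.
  have c2 : 0 <= (4 / n%:R : R) <= 1.
    by rewrite divr_ge0//= ler_pdivrMr//; lra.
  have := chord_exprn n t01 c1; have := chord_exprn n t01 c2.
  have -> : t * (4 / n%:R) = 2 * p by rewrite /t /p; field; rewrite gt_eqF.
  have -> : t * (2 / n%:R) = p by rewrite /t /p; field; rewrite gt_eqF.
  move: ((1 - 2 * p) ^+ n) ((1 - p) ^+ n) => x y.
  move: ((1 - 4 / n%:R) ^+ n) ((1 - 2 / n%:R) ^+ n) => x' y'.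
  rewrite /t => hx hy hxy.
  (* The chords bound the return probability by 1 - 3t/4 + t(x'/4 + y'/2), which is less than 1 - 9
     alpha/8 + alpha/8 = 1 - alpha. *)
  have : 0 < alpha * (1 / 12 - (x' / 4 + y' / 2)) by rewrite mulr_gt0// subr_gt0.
  by lra.
have mS := @measurable_sumX_eq R n (D * 0%:~R).
(* Compare with the event that the sum is nonzero. *)
apply: lt_le_trans (iid_lattice_law_le _ (leq_trans _ n4)
  (measurableC mS) (measurable_ratio_event _ _) _) => //.
- rewrite probability_setC// -[X in (1 - X)%E]fineK ?fin_num_measure//.
  by rewrite -EFinB lte_fin; move: U0; rewrite /U /sumX_pmf; lra.
- move=> s s0 sL [m sm] /=; rewrite sL gt_eqF//; split=> //.
  have m0 : m != 0 by apply: contra_notN s0 => /eqP <-.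
  apply: lt_le_trans (scaled_sqrt_lt L0 sg0 u0 k0 xi1) _.
  rewrite subrr mulr0 mul0r subr0 normrM normfV (gtr0_norm L0).
  rewrite ler_pM2r ?invr_gt0//.
  rewrite /meanX -/(sumX s) sm /D -mulrA mulKf ?gt_eqF// normrM.
  rewrite ger0_norm ?sqrtr_ge0// ler_peMr ?sqrtr_ge0//.
  by rewrite -intr_norm -[1]/(1%:~R) ler_int; case: m m0 {sm} => [[]|].
Qed.

Lemma ratio_tail_large (R : realType) (n : nat) (L sg u alpha xi : R) :
  (0 < n)%N -> 0 < L -> 0 <= sg -> 0 < u -> 2 / 3 <= alpha -> alpha < 1 ->
  xi < 1 ->
  exists Q : probability (R * R)%type R,
    [/\ ('E_Q[fun z => z.2] = L%:E)%E, ('E_Q[(fun z => z.1 ^+ 2)%R] = u%:E)%E,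
        ('E_Q[(fun z => z.2 ^+ 2)%R] = (L ^+ 2)%:E)%E
      & (alpha%:E < iid_law Q n
           [set s | (meanY s != 0 /\
              xi * Num.sqrt (u / (L + sg) ^+ 2 / (3 * n%:R * alpha)) <
              `| meanX s / meanY s
                 - fine 'E_Q[fun z => z.1] / fine 'E_Q[fun z => z.2] |)%R])%E].
Proof.
move=> n1 L0 sg0 u0 al23 al1 xi1.
have nR : (1 : R) <= n%:R by rewrite ler1n.
have n0 : (0 : R) < n%:R by lra.
pose k := 3 * n%:R * alpha.
have k0 : 0 < k by rewrite /k !mulr_gt0//; lra.
(* The sum has expectation n D p = D/2; [D] below is fixed by D^2 p = u. *)
pose p : R := (2 * n%:R)^-1.
have h0 : 0 <= p by rewrite invr_ge0 mulr_ge0.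
have q0 : 0 <= 1 - p by rewrite subr_ge0 invf_le1; lra.
have wE : (1 - p) + p + 0 = 1 by ring.
pose D := 2 * n%:R * Num.sqrt (u / (2 * n%:R)).
have [EX EY EX2 EY2] := lattice_law_moments D L (sum_weight3 q0 h0 (lexx 0) wE).
exists (discrete_law (lattice_atom D L) (sum_weight3 q0 h0 (lexx 0) wE)).
rewrite EX EY EX2 EY2/=; split=> //.
  congr _%:E; rewrite /D exprMn sqr_sqrtr ?divr_ge0 ?mulr_ge0// ?ltW//.
  by rewrite /p; field; rewrite !gt_eqF.
(* Compare with the whole space: the deviation is large almost surely. *)
apply: lt_le_trans (iid_lattice_law_le _ n1
  measurableT (measurable_ratio_event _ _) _) => //.
- by rewrite probability_setT lte_fin.
- move=> s _ sL [m sm] /=; rewrite sL gt_eqF//; split=> //.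
  apply: lt_le_trans (scaled_sqrt_lt L0 sg0 u0 k0 xi1) _.
  rewrite -mulrBl normrM normfV (gtr0_norm L0).
  rewrite ler_pM2r ?invr_gt0//.
  rewrite /meanX -/(sumX s) sm subr0.
  (* The deviation is an odd multiple of sqrt(u/(2n)), hence at least that in absolute value. *)
  have -> : n%:R^-1 * (D * m%:~R) - D * p
      = Num.sqrt (u / (2 * n%:R)) * (2 * m - 1)%:~R.
    by rewrite intrB intrM /D /p; field; rewrite gt_eqF.
  rewrite normrM ger0_norm ?sqrtr_ge0//.
  (* Here alpha >= 2/3 enters, as 2n <= 3 n alpha. *)
  apply: (@le_trans _ _ (Num.sqrt (u / (2 * n%:R)))).
    apply: ler_wsqrtr; rewrite ler_pM2l// lef_pV2 ?posrE ?mulr_gt0//; last by lra.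
    by rewrite /k; have : 0 <= n%:R * (3 * alpha - 2) by [apply: mulr_ge0; lra]; lra.
  rewrite ler_peMr ?sqrtr_ge0// -intr_norm -[1]/(1%:~R) ler_int.
  by case: (ltrP 0 m) => hm; lia.
Qed.

Theorem theorem5p4 (R : realType) (n : nat) (lY uX uY alpha xi : R) :
  (7 <= n)%N -> 0 < lY -> 0 < uX -> 0 < uY -> lY ^+ 2 <= uY ->
  0 < alpha ->
  alpha < Num.min 1 (n%:R / (lY + Num.sqrt (uY - lY ^+ 2)) ^+ 2) ->
  xi < 1 ->
  let v := uX / (lY + Num.sqrt (uY - lY ^+ 2)) ^+ 2 in
  exists Q : probability (R * R)%type R,
    [/\ (lY%:E <= 'E_Q[fun z => z.2])%E,
        ('E_Q[(fun z => z.1 ^+ 2)%R] <= uX%:E)%E,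
        ('E_Q[(fun z => z.2 ^+ 2)%R] <= uY%:E)%E
      & (alpha%:E < iid_law Q n
           [set s | (meanY s != 0 /\
              xi * Num.sqrt (v / (3 * n%:R * alpha)) <
              `| meanX s / meanY s
                 - fine 'E_Q[fun z => z.1] / fine 'E_Q[fun z => z.2] |)%R])%E].
Proof.
move=> n7 L0 u0 _ LU al0; rewrite lt_min => /andP[al1 _] xi1 v.
have n4 : (4 <= n)%N by exact: leq_trans n7.
have n1 : (0 < n)%N by exact: leq_trans n7.
have [Q [EY EX2 EY2 tail]] := match lerP alpha (2 / 3) with
  | LerNotGt h => ratio_tail_small n4 L0 (sqrtr_ge0 (uY - lY ^+ 2)) u0 al0 h xi1
  | GtrNotLe h => ratio_tail_large n1 L0 (sqrtr_ge0 (uY - lY ^+ 2)) u0 (ltW h) al1 xi1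
  end.
exists Q; split; [by rewrite EY|by rewrite EX2|by rewrite EY2 lee_fin|exact: tail].
Qed.
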